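(* Let $T,M>0$, let $A(p,t)=[a^{ij}(p,t)]$ be a symmetric, positive semi-definite $n\times n$ matrix depending smoothly on $(p,t)\in\mathbb{R}^n\times[0,T]$, and let $b:\mathbb{R}^n\times[0,T]\to\mathbb{R}$. Let $u:\mathbb{R}^n\times[0,T]\to\mathbb{R}$ be a smooth solution of $$\frac{\partial u}{\partial t}=a^{ij}(Du,t)D_{ij}u+b(Du,t),\qquad u(x,0)=u_0(x),$$ where $u_0$ is smooth with $\operatorname{osc}u_0\le M$ and $u$ is spatially periodic with respect to some lattice $\Gamma$ of $\mathbb{R}^n$, as is $u_0$. Suppose that $\alpha(p,t)=\tilde\alpha(|p|)>0$ for all $p$, where $\alpha$ is the function defined in the context. If there are positive constants $A_0$ and $P$ such that $$\tilde\alpha(|p|)\,|p|^2\ge A_0\quad\text{for }|p|\ge P,$$ then there are $T'>0$, $C_1$ and $C_2$, depending only on $n,M,A_0$ and $P$, such that for all $t\in(0,T']$ (with $t\le T$) $$|Du(\cdot,t)|\le C_1\sqrt{t}\,(1+t)\exp(C_2/t).$$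
   Context: Repeated indices are summed; $\operatorname{osc}f=\sup f-\inf f$. For the matrix $A(p,t)$ define $$\alpha(p,t):=|p|^2\inf_{v\in S^{n-1},\ v\cdot p\neq0}\frac{v^TA(p,t)v}{(v\cdot p)^2}.$$ The hypothesis $\alpha(p,t)=\tilde\alpha(|p|)$ means that $\alpha$ depends only on $|p|$, through the function $\tilde\alpha$; at $p=0$, where the formula is not meaningful, $\tilde\alpha(0)>0$ is understood as the continuous extension of $\tilde\alpha$. *)

(* Defs.v *)
From HB Require Import structures.
From mathcomp Require Import all_boot all_order all_algebra.
From mathcomp Require Import all_classical all_reals all_analysis.

Set Implicit Arguments.
Unset Strict Implicit.
Unset Printing Implicit Defensive.

Import Order.TTheory GRing.Theory Num.Theory.
Import numFieldNormedType.Exports.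

Local Open Scope classical_set_scope.
Local Open Scope ring_scope.

(* The library norm on 'rV[R]_n is the sup norm, so the Euclidean structure
   is defined here. *)
Definition dotv (R : realType) (n : nat) (v w : 'rV[R]_n) : R :=
  \sum_(i < n) v 0 i * w 0 i.

Definition enorm (R : realType) (n : nat) (v : 'rV[R]_n) : R :=
  Num.sqrt (dotv v v).

Definition qform (R : realType) (n : nat) (A : 'M[R]_n) (v : 'rV[R]_n) : R :=
  (v *m A *m v^T) 0 0.

Definition psdmx (R : realType) (n : nat) (A : 'M[R]_n) : Prop :=
  forall v : 'rV[R]_n, 0 <= qform A v.

(* Only meaningful for p != 0: the set is empty at p = 0. *)
Definition alpha (R : realType) (n : nat) (A : 'M[R]_n) (p : 'rV[R]_n) : R :=
  enorm p ^+ 2 *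
  inf [set qform A v / dotv v p ^+ 2 | v in
        [set v : 'rV[R]_n | enorm v = 1 /\ dotv v p != 0]].

(* sup and inf are real-valued, hence meaningful for bounded f; this covers
   continuous periodic functions. *)
Definition osc (R : realType) (X : Type) (f : X -> R) : R :=
  sup (range f) - inf (range f).

(* Directional difference quotients using only points of D; on a slab
   R^n x [0, T] these give one-sided time derivatives at t = 0 and t = T. *)
Definition diffquot (R : realType) (V : normedModType R) (f : V -> R)
    (x v : V) (h : R) : R :=
  h^-1 * (f (x + h *: v) - f x).

Definition dir_within (R : realType) (V : normedModType R) (D : set V)
    (x v : V) : set_system R :=
  within [set h : R | D (x + h *: v)] 0^'.

Definition derivable_within (R : realType) (V : normedModType R) (D : set V)
    (f : V -> R) (x v : V) : Prop :=
  cvg (diffquot f x v @ dir_within D x v).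

Definition derive_within (R : realType) (V : normedModType R) (D : set V)
    (f : V -> R) (x v : V) : R :=
  lim (diffquot f x v @ dir_within D x v).

(* C^k up to the boundary; intended for D the whole space or a slab of
   positive thickness, where every direction enters D at every point. *)
Fixpoint Ck_on (R : realType) (V : normedModType R) (D : set V) (k : nat)
    (f : V -> R) : Prop :=
  {within D, continuous f} /\
  match k with
  | 0%N => True
  | k'.+1 => forall v : V,
      (forall x : V, D x -> derivable_within D f x v) /\
      Ck_on D k' (fun x => derive_within D f x v)
  end.

Definition smooth_on (R : realType) (V : normedModType R) (D : set V)
    (f : V -> R) : Prop :=
  forall k : nat, Ck_on D k f.

Definition slab (R : realType) (n : nat) (T : R) : set ('rV[R]_n * R) :=
  [set z | 0 <= z.2 <= T].

Definition partial (R : realType) (n : nat) (i : 'I_n) (f : 'rV[R]_n -> R)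
    (x : 'rV[R]_n) : R :=
  'D_(delta_mx 0 i) f x.

Definition grad (R : realType) (n : nat) (f : 'rV[R]_n -> R) (x : 'rV[R]_n) :
    'rV[R]_n :=
  \row_i partial i f x.

Definition dtime (R : realType) (n : nat) (T : R) (u : 'rV[R]_n * R -> R)
    (x : 'rV[R]_n) (t : R) : R :=
  derive_within (slab T) u (x, t) (0, 1).

Definition lattice (R : realType) (n : nat) (G : set 'rV[R]_n) : Prop :=
  exists2 B : 'M[R]_n, B \in unitmx &
    G = range (fun k : 'rV[int]_n => map_mx intr k *m B).

Definition lattice_periodic (R : realType) (n : nat) (G : set 'rV[R]_n)
    (f : 'rV[R]_n -> R) : Prop :=
  forall g x : 'rV[R]_n, G g -> f (x + g) = f x.

(* The equation is imposed for 0 < t <= T; at t = 0 the initial condition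
   takes its place. *)
Definition solves (R : realType) (n : nat) (T : R)
    (A : 'rV[R]_n * R -> 'M[R]_n) (b : 'rV[R]_n * R -> R)
    (u : 'rV[R]_n * R -> R) : Prop :=
  forall (x : 'rV[R]_n) (t : R), 0 < t <= T ->
    let ut := fun y : 'rV[R]_n => u (y, t) in
    dtime T u x t =
      \sum_(i < n) \sum_(j < n)
        A (grad ut x, t) i j * partial i (partial j ut) x
      + b (grad ut x, t).

(* Main.v *)
(* Doubling of variables.  Maximise
     Z(x, y, t) = u(y, t) - u(x, t) + k t - c ln (1 + |y - x| / a).
   At a maximum with t > 0 the two gradients agree, so b cancels, and the
   difference H of the Hessians is negative semidefinite; hence
   k + tr (A H) >= 0.  With k = -c -> 0 this shows that the oscillation stays
   at most M.  If alpha |p|^2 >= A0 at p = Du, then A minus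
   alpha p^T p / |p|^2 is still positive semidefinite, and the second variation
   along (w, -w), w = y - x, improves the bound to tr (A H) <= - 4 A0 / c,
   because the logarithm satisfies phi'' / phi'^2 = - 1 / c.  With
   c = 2 A0 t0 / M and k = 2 A0 / c one has k t0 = M and obtains
   u(y, t0) - u(x, t0) <= c ln (1 + |y - x| / a), with a chosen so that the slope
   of the barrier is at least P where it matters; its slope at 0 is
   P exp (M^2 / (2 A0 t0)). *)
Require Import Defs.
From HB Require Import structures.
From mathcomp Require Import all_boot all_order all_algebra.
From mathcomp Require Import all_classical all_reals all_analysis.
From mathcomp Require Import ring lra.
Import Order.TTheory GRing.Theory Num.Theory.
Import numFieldNormedType.Exports.
Local Open Scope classical_set_scope.
Local Open Scope ring_scope.

(** * Euclidean norm, quadratic forms and positive semidefinite matrices *)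

Section Euclidean.
Context {R : realType} {n : nat}.
Implicit Types (v w : 'rV[R]_n) (A B H : 'M[R]_n).

Lemma dotvC v w : dotv v w = dotv w v.
Proof. by apply: eq_bigr => i _; rewrite mulrC. Qed.

Lemma dotvDl v1 v2 w : dotv (v1 + v2) w = dotv v1 w + dotv v2 w.
Proof. by rewrite /dotv -big_split; apply: eq_bigr => i _; rewrite mxE mulrDl. Qed.

Lemma dotvZl c v w : dotv (c *: v) w = c * dotv v w.
Proof. by rewrite /dotv big_distrr; apply: eq_bigr => i _; rewrite mxE -mulrA. Qed.

Lemma dotvDr v w1 w2 : dotv v (w1 + w2) = dotv v w1 + dotv v w2.
Proof. by rewrite dotvC dotvDl !(dotvC _ v). Qed.

Lemma dotvZr c v w : dotv v (c *: w) = c * dotv v w.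
Proof. by rewrite dotvC dotvZl dotvC. Qed.

Lemma dotv_delta v i : dotv v (delta_mx 0 i) = v 0 i.
Proof.
rewrite /dotv (bigD1 i)//= !mxE !eqxx mulr1 big1 ?addr0// => j ji.
by rewrite mxE (negbTE ji) andbF mulr0.
Qed.

Lemma dotvv_ge0 v : 0 <= dotv v v.
Proof. by apply: sumr_ge0 => i _; rewrite -expr2 sqr_ge0. Qed.

Lemma enorm_ge0 v : 0 <= enorm v. Proof. exact: sqrtr_ge0. Qed.

Lemma enorm_sqr v : enorm v ^+ 2 = dotv v v.
Proof. by rewrite sqr_sqrtr// dotvv_ge0. Qed.

Lemma enormZ c v : enorm (c *: v) = `|c| * enorm v.
Proof. by rewrite /enorm dotvZl dotvZr mulrA -expr2 sqrtrM ?sqr_ge0// sqrtr_sqr. Qed.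

Lemma enorm0 : enorm (0 : 'rV[R]_n) = 0.
Proof. by rewrite -(scale0r 0) enormZ normr0 mul0r. Qed.

Lemma coord_le_enorm v i : `|v 0 i| <= enorm v.
Proof.
rewrite -sqrtr_sqr ler_wsqrtr// /dotv (bigD1 i)//= -expr2 lerDl.
by apply: sumr_ge0 => j _; rewrite -expr2 sqr_ge0.
Qed.

Lemma enorm_gt0 v : (0 < enorm v) = (v != 0).
Proof.
rewrite lt_neqAle enorm_ge0 andbT eq_sym; congr negb.
apply/eqP/eqP => [v0|->]; last exact: enorm0.
apply/rowP => i; rewrite mxE; apply/eqP.
by rewrite -normr_le0 -v0 coord_le_enorm.
Qed.

(** The gap between the two sides is the square [(enorm (v + w) - enorm v) ^+ 2] divided by
    [2 * enorm v]. The bound is a quadratic majorant of the norm that touches it at [w = 0]. *)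
Lemma enormD_le v w : 0 < enorm v ->
  enorm (v + w) <= enorm v + dotv v w / enorm v + dotv w w / (2 * enorm v).
Proof.
move=> v0; set r := enorm v in v0 *.
have vw : 0 <= enorm (v + w) ^+ 2 by exact: sqr_ge0.
have e : enorm (v + w) ^+ 2 = r ^+ 2 + 2 * dotv v w + dotv w w.
  by rewrite !enorm_sqr dotvDl !dotvDr (dotvC w v); ring.
set N := enorm (v + w) in vw e *.
rewrite -subr_ge0.
have -> : r + dotv v w / r + dotv w w / (2 * r) - N = (N - r) ^+ 2 / (2 * r).
  have -> : (N - r) ^+ 2 = 2 * r ^+ 2 + 2 * dotv v w + dotv w w - 2 * N * r.
    by rewrite sqrrB e; ring.
  by field; rewrite gt_eqF.
by rewrite divr_ge0 ?sqr_ge0// mulr_ge0 ?ltW.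
Qed.

Lemma qformE A v : qform A v = \sum_(i < n) \sum_(j < n) A i j * (v 0 i * v 0 j).
Proof.
rewrite /qform mxE exchange_big; apply: eq_bigr => j _ /=.
by rewrite !mxE big_distrl; apply: eq_bigr => i _ /=; ring.
Qed.

Lemma qformZ c A v : qform A (c *: v) = c ^+ 2 * qform A v.
Proof.
rewrite !qformE big_distrr; apply: eq_bigr => i _.
by rewrite big_distrr; apply: eq_bigr => j _ /=; rewrite !mxE; ring.
Qed.

Lemma qformB_rank1 A c w v :
  qform (A - c *: (w^T *m w)) v = qform A v - c * dotv v w ^+ 2.
Proof.
rewrite !qformE expr2 /dotv big_distrlr big_distrr -sumrB; apply: eq_bigr => i _.
rewrite big_distrr -sumrB; apply: eq_bigr => j _ /=.
by rewrite !mxE big_ord1 !mxE; ring.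
Qed.

Lemma qform_delta_shift A v k s : A^T = A ->
  qform A (s *: delta_mx 0 k + v) =
    s ^+ 2 * A k k + 2 * s * dotv v (row k A) + qform A v.
Proof.
move=> As.
have e1 : (row k A *m (delta_mx 0 k : 'rV[R]_n)^T) 0 0 = A k k.
  by rewrite trmx_delta -colE !mxE.
have e2 : (row k A *m v^T) 0 0 = dotv v (row k A).
  by rewrite mxE; apply: eq_bigr => i _; rewrite !mxE mulrC.
have e3 : (v *m A *m (delta_mx 0 k : 'rV[R]_n)^T) 0 0 = dotv v (row k A).
  rewrite trmx_delta -colE !mxE; apply: eq_bigr => i _.
  by rewrite !mxE -[in LHS]As mxE.
rewrite /qform linearP /= mulmxDl -scalemxAl -rowE mulmxDr !mulmxDl -!scalemxAr.
have D (X Y : 'M[R]_1) : (X + Y) 0 0 = X 0 0 + Y 0 0 by rewrite mxE.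
have Z c (X : 'M[R]_1) : (c *: X) 0 0 = c * X 0 0 by rewrite mxE.
by rewrite -!scalemxAl !(D, Z) e1 e2 e3; ring.
Qed.

(** Cauchy-Schwarz for the semidefinite form, between [v] and a coordinate vector: the polynomial
    [qform A (s *: delta_mx 0 k + v)] in [s] is nonnegative, so its discriminant is not positive. *)
Lemma psd_qform_cauchy A v k : A^T = A -> psdmx A ->
  dotv v (row k A) ^+ 2 <= A k k * qform A v.
Proof.
move=> As Apsd; set d := dotv v (row k A).
have q s : 0 <= s ^+ 2 * A k k + 2 * s * d + qform A v.
  by rewrite -qform_delta_shift.
have Akk : 0 <= A k k.
  by have := Apsd (1 *: delta_mx 0 k + 0); rewrite qform_delta_shift// /qform !mul0mx mxE
    /dotv big1 ?mulr0 ?addr0 ?expr1n ?mul1r// => i _; rewrite mxE mul0r.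
move: Akk; rewrite le_eqVlt => /predU1P[Ak|Ak]; last first.
  (* The minimiser of the polynomial. *)
  have := q (- d / A k k).
  have -> : (- d / A k k) ^+ 2 * A k k + 2 * (- d / A k k) * d + qform A v =
    (A k k * qform A v - d ^+ 2) / A k k by field; rewrite gt_eqF.
  by rewrite pmulr_lge0 ?invr_gt0// subr_ge0.
rewrite -Ak mul0r; have [->|d0] := eqVneq d 0; first by rewrite expr0n.
(* With leading coefficient 0 the polynomial is affine in [s]; this choice of [s] gives it the value
   -1. *)
have := q (- (qform A v + 1) / (2 * d)).
rewrite -Ak mulr0 add0r => h; exfalso; move: h; apply/negP; rewrite -ltNge.
have -> : 2 * (- (qform A v + 1) / (2 * d)) * d = - (qform A v + 1) by field.
by rewrite opprD addrAC addNr add0r oppr_lt0 ltr01.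
Qed.

Lemma psd_trace_le0 A H : A^T = A -> psdmx A -> (forall v, qform H v <= 0) ->
  \sum_(i < n) \sum_(j < n) A i j * H i j <= 0.
Proof.
(* Gaussian elimination writes A as a sum of rank one matrices w^T w. *)
move=> As Apsd Hneg.
(* Induction on the number [m] of leading rows that may be nonzero; the last of them is the pivot
   row removed in the inductive step. *)
suff: forall m B, B^T = B -> psdmx B -> (forall i j : 'I_n, (m <= i)%N -> B i j = 0) ->
    \sum_(i < n) \sum_(j < n) B i j * H i j <= 0.
  by move=> /(_ n A As Apsd); apply => i j; rewrite leqNgt ltn_ord.
elim=> [|m IH] B Bs Bpsd Bm.
  by rewrite big1// => i _; rewrite big1// => j _; rewrite Bm// mul0r.
have [mn|nm] := ltnP m n; last first.
  by apply: IH => // i j mi; have := leq_trans nm mi; rewrite leqNgt ltn_ord.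
pose k := Ordinal mn.
(* The Schur complement. Since the inverse of 0 is 0, a vanishing pivot gives [C = B]; this is
   harmless because the whole pivot row then vanishes by Cauchy-Schwarz. *)
pose C := B - (B k k)^-1 *: ((row k B)^T *m row k B).
have Cij i j : C i j = B i j - (B k k)^-1 * (B k i * B k j).
  by rewrite !mxE big_ord1 !mxE.
have Bij i j : B i j = B j i by rewrite -[in LHS]Bs mxE.
have Bkk : 0 <= B k k.
  by have := Bpsd (delta_mx 0 k); rewrite /qform -rowE trmx_delta -colE !mxE.
have rowk : B k k = 0 -> forall j, B k j = 0.
  move=> b0 j; apply/eqP; rewrite -sqrf_eq0 eq_le sqr_ge0 andbT.
  have := psd_qform_cauchy B (delta_mx 0 j) k Bs Bpsd.
  by rewrite b0 mul0r dotvC dotv_delta mxE.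
have Cs : C^T = C.
  by apply/matrixP => i j; rewrite mxE !Cij Bij (mulrC (B k i)).
have Cpsd : psdmx C.
  move=> v; rewrite qformB_rank1 subr_ge0.
  move: Bkk; rewrite le_eqVlt => /predU1P[b0|b0].
    by rewrite -b0 invr0 mul0r.
  by rewrite mulrC ler_pdivrMr// mulrC psd_qform_cauchy.
have Cm (i j : 'I_n) : (m <= i)%N -> C i j = 0.
  rewrite leq_eqVlt Cij => /orP[/eqP mi|mi].
    have -> : i = k by exact: val_inj.
    have [b0|b0] := eqVneq (B k k) 0; first by rewrite !(rowk b0) !mul0r mulr0 subrr.
    by rewrite mulrA mulVf// mul1r subrr.
  have Bki : B k i = 0 by rewrite Bij Bm.
  by rewrite Bki mul0r mulr0 subr0 Bm.
have -> : \sum_(i < n) \sum_(j < n) B i j * H i j =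
    \sum_(i < n) \sum_(j < n) C i j * H i j + (B k k)^-1 * qform H (row k B).
  rewrite qformE big_distrr -big_split; apply: eq_bigr => i _.
  rewrite big_distrr -big_split; apply: eq_bigr => j _ /=.
  by rewrite Cij !mxE; ring.
rewrite -[leRHS]addr0 lerD//; first exact: (IH C Cs Cpsd Cm).
by rewrite mulr_ge0_le0// invr_ge0.
Qed.

(** The quotient in [alpha] is homogeneous of degree 0 in [v], so the infimum over unit vectors
    bounds it for every [v] not orthogonal to [p]. In other words, [A] minus [alpha A p] times the
    projection onto [p] is still positive semidefinite. *)
Lemma alpha_rank1 A p v : psdmx A -> p != 0 ->
  alpha A p * dotv v p ^+ 2 <= enorm p ^+ 2 * qform A v.
Proof.
move=> Apsd p0; rewrite /alpha -mulrA ler_wpM2l ?sqr_ge0//.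
have [->|vp] := eqVneq (dotv v p) 0; first by rewrite expr0n mulr0.
have v0 : 0 < enorm v.
  rewrite enorm_gt0; apply: contraNneq vp => ->.
  by rewrite /dotv big1// => i _; rewrite mxE mul0r.
have vp2 : 0 < dotv v p ^+ 2 by rewrite exprn_even_gt0.
rewrite -ler_pdivlMr//; apply: ge_inf.
  by exists 0 => _ /= [w _ <-]; rewrite divr_ge0// sqr_ge0.
exists ((enorm v)^-1 *: v) => /=.
  split; first by rewrite enormZ ger0_norm ?invr_ge0 ?enorm_ge0// mulVf// gt_eqF.
  by rewrite dotvZl mulf_neq0// invr_eq0 gt_eqF.
by rewrite qformZ dotvZl exprMn; field; rewrite vp gt_eqF.
Qed.

End Euclidean.

(** * First and second derivative tests in one variable *)

Section OneVariable.
Context {R : realType}.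
Implicit Types f g k : R -> R.

Lemma is_derive_local_max g (d : R) : (\forall h \near (0 : R), derivable g h 1) ->
  is_derive (0 : R) 1 g d -> (\forall h \near (0 : R), g h <= g 0) -> d = 0.
Proof.
move=> dg g0 gmax.
have /nbhs_ballP[e /= e0 He] : \forall h \near (0 : R), derivable g h 1 /\ g h <= g 0.
  exact: filterI.
have Ie h : h \in `](- e), e[ -> derivable g h 1 /\ g h <= g 0.
  rewrite in_itv /= => he; apply: He.
  by rewrite /ball /= sub0r normrN ltr_norml.
have : is_derive (0 : R) 1 g 0.
  apply: (@derive1_at_max _ _ (- e) e) => [|h /Ie[]//||h /Ie[]//].
    by rewrite ge0_cp// ltW.
  by rewrite in_itv /= oppr_lt0 e0.
move=> gz; rewrite -(@derive_val _ _ _ _ _ _ _ g0).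
exact: (@derive_val _ _ _ _ _ _ _ gz).
Qed.

(** If [l > 0], then [k h / h > 0] near 0 because [k 0 = 0]; so [k] is positive just to the right of
    0, and the mean value theorem makes [g] exceed [g 0] there. *)
Lemma local_max_second_derive g k (l : R) :
  (\forall h \near (0 : R), is_derive (h : R) 1 g (k h)) -> is_derive (0 : R) 1 k l ->
  (\forall h \near (0 : R), g h <= g 0) -> l <= 0.
Proof.
move=> dg k0 gmax; rewrite leNgt; apply/negP => l0.
have kz : k 0 = 0.
  apply: is_derive_local_max gmax; last exact: nbhs_singleton dg.
  by apply: filterS dg => h ?; exact: ex_derive.
have kpos : \forall h \near 0^', 0 < h^-1 * k h.
  have : h^-1 *: ((k \o shift 0) (h *: 1) - k 0) @[h --> 0^'] --> l.
    by rewrite -(@derive_val _ _ _ _ _ _ _ k0); exact: ex_derive.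
  move/(cvgr_gt _) => /(_ _ l0); apply: filterS => h /=.
  by rewrite kz subr0 addr0 scaler1.
have /nbhs_ballP[e1 /= e10 He1] : \forall h \near (0 : R),
    is_derive (h : R) 1 g (k h) /\ g h <= g 0 by exact: filterI.
have /nbhs_ballP[e2 /= e20 He2] : \forall h \near (0:R), h != 0 -> 0 < h^-1 * k h.
  exact: kpos.
pose e := Num.min e1 e2 / 2.
have e0 : 0 < e by rewrite divr_gt0// lt_min e10.
have ee : e < Num.min e1 e2.
  by rewrite /e ltr_pdivrMr// ltr_pMr ?lt_min ?e10// (ltr_nat _ 1 2).
have Ie h : 0 <= h <= e -> [/\ is_derive (h : R) 1 g (k h), g h <= g 0 & (h != 0 -> 0 < h^-1 * k h)].
  move=> /andP[h0 he].
  have /andP[h1 h2] : (h < e1) && (h < e2) by rewrite -lt_min (le_lt_trans he).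
  have [|? ?] := He1 h; first by rewrite /ball /= sub0r normrN ger0_norm.
  split => //; apply: (He2 h).
  by rewrite /ball /= sub0r normrN ger0_norm.
have [||c] := @MVT _ g k 0 e e0.
- move=> h; rewrite in_itv /= => /andP[h0 he].
  by have [|? _ _] := Ie h => //; rewrite !ltW.
- apply: derivable_within_continuous => h; rewrite in_itv /= => he.
  by have [? _ _] := Ie h he; exact: ex_derive.
rewrite in_itv /= => /andP[c0 ce] eg.
have [|_ _ /(_ (lt0r_neq0 c0))] := Ie c; first by rewrite !ltW.
rewrite pmulr_rgt0 ?invr_gt0// => kc.
have [|_ + _] := Ie e; first by rewrite ltW//=.
by rewrite -subr_le0 eg subr0 leNgt mulr_gt0.
Qed.

End OneVariable.

(** * Directional derivatives and their linear dependence on the direction *)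

Section Directional.
Context {R : realType} {n : nat}.
Implicit Types (f : 'rV[R]_n -> R) (x v w : 'rV[R]_n).

Lemma is_derive_line f x v (h : R) : derivable f (x + h *: v) v ->
  is_derive h 1 (fun s => f (x + s *: v)) ('D_v f (x + h *: v)).
Proof.
have e : (fun k : R => k^-1 *: (((fun s => f (x + s *: v)) \o shift h) (k *: 1)
      - f (x + h *: v))) =
    (fun k => k^-1 *: ((f \o shift (x + h *: v)) (k *: v) - f (x + h *: v))).
  apply/funext => k /=; congr (_ *: (f _ - _)).
  by rewrite scaler1 scalerDl addrCA.
by move=> df; split; rewrite /derivable /derive e.
Qed.

Lemma is_derive_lineZ f x v (c s : R) :
  derivable f (x + (s * c) *: v) v ->
  is_derive s 1 (fun s => f (x + (s * c) *: v)) (c * 'D_v f (x + (s * c) *: v)).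
Proof.
move=> df.
have dc : is_derive s 1 (fun s : R => s * c) c.
  have := is_deriveZ c (is_derive_id s (1 : R)).
  rewrite /GRing.scale /= mulr1; congr (is_derive _ _ _ _).
  by apply/funext => y /=; rewrite mulrC.
have := @is_derive1_comp _ (fun h => f (x + h *: v)) (fun s => s * c) s _ _
  (is_derive_line f x v (s * c) df) dc.
by rewrite mulrC.
Qed.

(** C^1 regularity stated direction by direction, the form in which [Ck_on] supplies it. Linearity
    in [v] is not part of the definition and is derived below. *)
Definition dir_C1 f := forall v, (forall x, derivable f x v) /\ continuous ('D_v f).

Lemma dir_deriveZ f x v c : dir_C1 f -> 'D_(c *: v) f x = c * 'D_v f x.
Proof.
move=> f1.
have d1 : derivable f (x + 0 *: (c *: v)) (c *: v) by exact: (f1 _).1.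
have d2 : derivable f (x + (0 * c) *: v) v by exact: (f1 _).1.
have e1 := @derive_val _ _ _ _ _ _ _ (is_derive_line _ _ _ _ d1).
have e2 := @derive_val _ _ _ _ _ _ _ (is_derive_lineZ _ _ _ _ _ d2).
move: e2 e1; rewrite mul0r !scale0r addr0.
have -> : (fun s : R => f (x + (s * c) *: v)) = (fun s : R => f (x + s *: (c *: v))).
  by apply/funext => s; rewrite scalerA.
by move=> -> <-.
Qed.

Lemma dir_mean_value f x v c : dir_C1 f ->
  exists2 s, 0 <= s <= 1 & f (x + c *: v) - f x = c * 'D_v f (x + (s * c) *: v).
Proof.
move=> f1.
have d (s : R) : is_derive s 1 (fun s => f (x + (s * c) *: v)) (c * 'D_v f (x + (s * c) *: v)).
  by apply: is_derive_lineZ; exact: (f1 _).1.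
have [||s] := @MVT_segment _ _ _ 0 1 _ (fun s _ => d s).
- exact: ler01.
- by apply: derivable_within_continuous => s _; have ? := d s; exact: ex_derive.
by rewrite in_itv /= mul1r mul0r scale0r addr0 subr0 mulr1 => s01 ->; exists s.
Qed.

(** The increment along [v + w] is split into a step along [v] from [x] and a step along [w] from
    the moved point. The mean value theorem turns the second quotient into ['D_w f] at a point that
    tends to [x], and continuity of ['D_w f] concludes. *)
Lemma dir_deriveD f x v w : dir_C1 f -> 'D_(v + w) f x = 'D_v f x + 'D_w f x.
Proof.
move=> f1; rewrite [LHS]/derive; apply/cvg_lim => //.
have -> : (fun h : R => h^-1 *: ((f \o shift x) (h *: (v + w)) - f x)) =
   (fun h => h^-1 *: ((f \o shift x) (h *: v) - f x) +
      h^-1 *: (f (x + h *: v + h *: w) - f (x + h *: v))).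
  apply/funext => h; rewrite -scalerDr; congr (_ *: _) => /=.
  by rewrite scalerDr (addrC _ x) addrA (addrC (h *: v)) [RHS]addrC addrA subrK.
apply: cvgD; first exact: (f1 v).1.
apply/cvgrPdist_lt => e e0.
have /cvgrPdist_lt/(_ e e0)/nbhs_ballP[r /= r0 Hr] := (f1 w).2 x.
(* The summand 1 keeps the divisor positive when [v] and [w] both vanish. *)
have vw0 : 0 < `|v| + `|w| + 1 by rewrite ltr_wpDl.
near=> h.
have h0 : h != 0 by near: h; exact: nbhs_dnbhs_neq.
have hr : `|h| * (`|v| + `|w| + 1) < r.
  rewrite -ltr_pdivlMr//; near: h; apply: dnbhs0_lt; exact: divr_gt0.
have [s /andP[s0 s1] ->] := dir_mean_value f (x + h *: v) w h f1.
rewrite /GRing.scale /= mulKf//; apply: Hr.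
rewrite -ball_normE /= -addrA opprD addrA subrr sub0r normrN (le_lt_trans _ hr)//.
rewrite (le_trans (ler_normD _ _))// !normrZ.
apply: (@le_trans _ _ (`|h| * (`|v| + `|w|))); last by rewrite ler_wpM2l// lerDl.
by rewrite mulrDr lerD2l ler_wpM2r// -[leRHS]mul1r ler_wpM2r// ger0_norm.
Unshelve. all: by end_near. Qed.

Lemma dir_derive_partial f x v : dir_C1 f ->
  'D_v f x = \sum_(i < n) v 0 i * partial i f x.
Proof.
move=> f1; rewrite [in LHS](row_sum_delta v).
rewrite (big_morph (fun v => 'D_v f x) (op1 := +%R) (id1 := 0)).
- by apply: eq_bigr => i _; rewrite dir_deriveZ.
- by move=> v1 v2; rewrite dir_deriveD.
- by rewrite -(scale0r 0) dir_deriveZ// mul0r.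
Qed.

Definition dir_C2 f := dir_C1 f /\ forall v, dir_C1 ('D_v f).

Definition hess f x : 'M[R]_n := \matrix_(i, j) partial i (partial j f) x.

Lemma dir_derive2_hess f x v : dir_C2 f -> 'D_v ('D_v f) x = qform (hess f x) v.
Proof.
move=> [f1 f2]; rewrite (dir_derive_partial _ x v (f2 v)).
rewrite qformE; apply: eq_bigr => i _.
have -> : 'D_v f = \sum_(j < n) (v 0 j \*: partial j f).
  by apply/funext => y; rewrite dir_derive_partial// fct_sumE.
have d (j : 'I_n) : is_derive x 'e_i (v 0 j \*: partial j f) (v 0 j *: partial i (partial j f) x).
  by apply: is_deriveZ; apply: derivableP; exact: (f2 _ _).1.
rewrite {1}/partial (@derive_val _ _ _ _ _ _ _ (is_derive_sum d)) big_distrr.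
by apply: eq_bigr => j _; rewrite mxE /GRing.scale /=; ring.
Qed.

End Directional.

(** * Continuity of the norm, of linear maps and of restricted compositions *)

Section Continuity.
Context {R : realType} {n : nat}.

Lemma continuous_sum_ord (X : topologicalType) (V : normedModType R) m (F : 'I_m -> X -> V) :
  (forall i, continuous (F i)) -> continuous (fun x => \sum_(i < m) F i x).
Proof.
move=> cF; elim: (index_enum _) => [|i r IH].
  by under eq_fun do rewrite big_nil; exact: cst_continuous.
under eq_fun do rewrite big_cons.
by move=> x; apply: cvgD; [exact: cF|exact: IH].
Qed.

Lemma continuous_mulmxr m (B : 'M[R]_(n, m)) : continuous (fun v : 'rV[R]_n => v *m B).
Proof.
under eq_fun do rewrite mulmx_sum_row.
apply: continuous_sum_ord => i x.
by apply: (@cvgZr_tmp _ _ _ (nbhs x)); exact: (@coord_continuous R 1 n 0 i x).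
Qed.

Lemma continuous_enorm : continuous (@enorm R n).
Proof.
move=> v; apply: continuous_comp; last exact: sqrt_continuous.
have : continuous (fun v : 'rV[R]_n => dotv v v).
  by apply: continuous_sum_ord => i x; apply: (@cvgM _ _ (nbhs x)); exact: (@coord_continuous R 1 n 0 i x).
exact.
Qed.

Lemma within_continuous_pull (X Y Z : topologicalType) (A : set X) (D : set Y)
    (f : X -> Y) (g : Y -> Z) :
  {within D, continuous g} -> continuous f -> (forall x, A x -> D (f x)) ->
  {within A, continuous (g \o f)}.
Proof.
move=> /subspace_continuousP cg cf AD; apply/subspace_continuousP => x Ax P gP.
have := cg _ (AD _ Ax) P gP; rewrite /nbhs /= /within /= => DP.
have := cf x _ DP; rewrite /nbhs /= => fP.
by apply: filterS fP => z /= zP Az; apply: zP; exact: AD.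
Qed.

End Continuity.

(** * From derivatives on the slab to derivatives of time slices *)

Section Slab.
Context {R : realType} {n : nat}.
Implicit Types (u g : 'rV[R]_n * R -> R) (x v : 'rV[R]_n) (T t : R).

Lemma slab_slice_continuous T g t : 0 <= t <= T ->
  {within slab T, continuous g} -> continuous (fun x => g (x, t)).
Proof.
move=> tT cg; apply/continuous_subspace_setT.
apply: (within_continuous_pull _ _ _ setT _ (fun x => (x, t)) _ cg) => // x.
by apply: (@cvg_pair _ _ _ (nbhs x) (nbhs x) (nbhs t)); [exact: cvg_id|exact: cvg_cst].
Qed.

(** A direction [(v, 0)] never leaves the slab, so the restricted filter is the full punctured
    neighbourhood of 0 and the derivative is the ordinary one of the slice. *)
Lemma is_derive_slice T u t x v : 0 <= t <= T ->
  derivable_within (slab T) u (x, t) (v, 0) ->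
  is_derive x v (fun y => u (y, t)) (derive_within (slab T) u (x, t) (v, 0)).
Proof.
move=> tT.
have F : dir_within (slab T) (x, t) (v, 0) = 0^'.
  rewrite /dir_within (_ : [set h | _] = setT).
    apply/seteqP; split => P.
      by rewrite /within /=; apply: filterS => h; exact.
    by rewrite /within /=; apply: filterS.
  by apply/seteqP; split => // h _ /=; rewrite /slab /= scaler0 addr0.
have e : diffquot u (x, t) (v, 0) =
    (fun h : R => h^-1 *: (((fun y => u (y, t)) \o shift x) (h *: v) - u (x, t))).
  apply/funext => h; rewrite /diffquot /= /GRing.scale /=; congr (_ * (u _ - _)).
  by congr (_, _) => /=; rewrite ?[h *: v + x]addrC // /GRing.scale /= mulr0 addr0.
by rewrite /derivable_within /derive_within F e => du; split.
Qed.

Lemma slice_dir_derive T u t v : 0 <= t <= T -> Ck_on (slab T) 1 u ->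
  'D_v (fun y => u (y, t)) = (fun x => derive_within (slab T) u (x, t) (v, 0)).
Proof.
move=> tT [_ /(_ (v, 0))[du _]]; apply/funext => x.
exact: (@derive_val _ _ _ _ _ _ _ (is_derive_slice T u t x v tT (du _ _))).
Qed.

Lemma slice_dir_C1 T u t : 0 <= t <= T -> Ck_on (slab T) 1 u ->
  dir_C1 (fun y => u (y, t)).
Proof.
move=> tT u1 v; split.
  move=> x; have [_ /(_ (v, 0))[du _]] := u1.
  exact: (@ex_derive _ _ _ _ _ _ _ (is_derive_slice T u t x v tT (du _ _))).
rewrite (slice_dir_derive T)//; have [_ /(_ (v, 0))[_ [du _]]] := u1.
exact: slab_slice_continuous du.
Qed.

Lemma slice_dir_C2 T u t : 0 <= t <= T -> Ck_on (slab T) 2 u ->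
  dir_C2 (fun y => u (y, t)).
Proof.
move=> tT [u0 u2].
have u1 : Ck_on (slab T) 1 u.
  by split => // v; have [du [cdu _]] := u2 v.
split; first exact: slice_dir_C1 u1.
move=> v; rewrite (slice_dir_derive T)//.
apply: (slice_dir_C1 T (fun z => derive_within (slab T) u z (v, 0)) t) => //.
by have [_] := u2 (v, 0).
Qed.

(** Backward difference quotients of a function that is maximal at the final time are nonnegative.
    Looking only backwards also covers [t = T]. *)
Lemma dtime_ge_of_max T u t x y (k : R) : 0 < t <= T -> Ck_on (slab T) 1 u ->
  (forall s, 0 <= s <= t -> u (y, s) - u (x, s) + k * s <= u (y, t) - u (x, t) + k * t) ->
  0 <= k + (dtime T u y t - dtime T u x t).
Proof.
move=> /andP[t0 tT] [_ /(_ (0, 1))[du _]] umax; rewrite leNgt; apply/negP => neg.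
have st (z : 'rV[R]_n) : slab T (z, t) by rewrite /slab /= ltW.
have Fx (z : 'rV[R]_n) : dir_within (slab T) (z, t) (0, 1) = within [set h | 0 <= t + h <= T] 0^'.
  have e : [set h : R | slab T ((z, t) + h *: (0, 1))] = [set h | 0 <= t + h <= T].
    by apply/funext => h; rewrite /slab /mkset /= /GRing.scale /= mulr1.
  by rewrite /dir_within e.
have cv (z : 'rV[R]_n) : diffquot u (z, t) (0, 1) @ within [set h | 0 <= t + h <= T] 0^' -->
    dtime T u z t by rewrite -(Fx z); apply: du; exact: st.
have : (fun h => k + (diffquot u (y, t) (0, 1) h - diffquot u (x, t) (0, 1) h))
    @ within [set h | 0 <= t + h <= T] 0^' --> k + (dtime T u y t - dtime T u x t).
  by apply: cvgD; [exact: cvg_cst|exact: cvgB].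
move=> /(cvgr_lt _)/(_ _ neg); rewrite /within /= => /nbhs_ballP[e /= e0 He].
(* The cap [t] keeps [t - h] in [[0, t]], where maximality is known. *)
pose h := Num.min (e / 2) t.
have h0 : 0 < h by rewrite lt_min t0 divr_gt0.
have he : h < e by rewrite gt_min (ltr_pdivrMr)// ltr_pMr// (ltr_nat _ 1 2).
have ht : h <= t by rewrite ge_min lexx orbT.
have := He (- h); rewrite /ball /= sub0r opprK gtr0_norm// => /(_ he).
rewrite oppr_eq0 gt_eqF// => /(_ isT).
rewrite subr_ge0 ht (le_trans _ tT) ?gerBl ?ltW// => /(_ isT).
have dq (z : 'rV[R]_n) : diffquot u (z, t) (0, 1) (- h) = (- h)^-1 * (u (z, t - h) - u (z, t)).
  rewrite /diffquot; congr (_ * (u _ - _)); congr (_, _) => /=.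
    by rewrite scaler0 addr0.
  by rewrite /GRing.scale /= mulr1.
rewrite !dq.
apply/negP; rewrite -leNgt.
have := umax (t - h); rewrite subr_ge0 ht gerBl (ltW h0) => /(_ isT) um.
rewrite -mulrBr invrN mulNr subr_ge0 mulrC ler_pdivrMr//.
move: (u (y, t)) (u (x, t)) (u (y, t - h)) (u (x, t - h)) um; clear => a b c d um; lra.
Qed.

End Slab.

(** * Reduction to a fundamental domain *)

Section Lattice.
Context {R : realType} {n : nat}.

(** Coordinates in a lattice basis are split into integer and fractional parts. The closed unit cube
    is used so that the domain is compact. *)
Lemma lattice_fundamental_domain (G : set 'rV[R]_n) : lattice G ->
  exists B : 'M[R]_n, forall x, exists f g : 'rV[R]_n,
    [/\ forall i, 0 <= f 0 i <= 1, G g & x = f *m B + g].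
Proof.
move=> [B Bu ->]; exists B => x.
have [y yE] : exists y, y = x *m invmx B by eexists.
pose k := map_mx Num.floor y.
exists (y - map_mx intr k), (map_mx intr k *m B); split.
- move=> i; rewrite !mxE subr_ge0 floor_le /= lerBlDl.
  by have := floorD1_gt (y 0 i); rewrite intrD => /ltW.
- by exists k.
- by rewrite -mulmxDl subrK yE mulmxKV.
Qed.

End Lattice.

(** * Existence of a maximum of the two-point function *)

Section TwoPointMaximum.
Context {R : realType} {n : nat}.
Implicit Types (u : 'rV[R]_n * R -> R) (x y : 'rV[R]_n).

Definition two_point u (k c a : R) x y (t : R) : R :=
  u (y, t) - u (x, t) + k * t - c * ln (1 + enorm (y - x) / a).

Let box (l r : R) : set 'rV[R]_n := [set v | forall i, `[l, r]%classic (v ord0 i)].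

Let compact_box l r : compact (box l r).
Proof.
exact: (@rV_compact R n (fun=> `[l, r]%classic) (fun=> @segment_compact R l r)).
Qed.

Lemma slab_periodic_bounded T u (G : set 'rV[R]_n) : 0 <= T ->
  {within slab T, continuous u} -> lattice G ->
  (forall t, 0 <= t <= T -> lattice_periodic G (fun x => u (x, t))) ->
  exists U, forall x t, 0 <= t <= T -> `|u (x, t)| <= U.
Proof.
move=> T0 cu /lattice_fundamental_domain[B GB] per.
pose K : set ('rV[R]_n * R) := box 0 1 `*` `[0, T]%classic.
have cK : compact K by apply: compact_setX; [exact: compact_box|exact: segment_compact].
have K0 : K !=set0.
  by exists (0, 0); split => [i|] /=; rewrite ?mxE in_itv /= lexx ?ler01.
pose h (z : 'rV[R]_n * R) := (z.1 *m B, z.2).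
have ch : continuous h.
  move=> z; apply: (@cvg_pair _ _ _ (nbhs z) (nbhs (z.1 *m B)) (nbhs z.2)).
    apply: (@cvg_comp _ _ _ fst (fun v => v *m B) (nbhs z) (nbhs z.1)).
      exact: cvg_fst.
    exact: continuous_mulmxr.
  exact: cvg_snd.
have cuh : {within K, continuous (fun z => `|(u \o h) z|)}.
  have := within_continuous_pull _ _ _ K _ h u cu ch (fun z Kz => Kz.2).
  move=> /subspace_continuousP c1; apply/subspace_continuousP => z Kz.
  by apply: cvg_norm; exact: c1.
have [z _ zmax] := compact_EVT_max K0 cK cuh.
exists `|(u \o h) z| => x t tT.
have [f [g [f01 Gg ->]]] := GB x; rewrite per//.
by apply: (zmax (f, t)); rewrite inE; split => [i|] /=; rewrite in_itv //=.
Qed.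

(** A common lattice translation of [x] and [y] changes nothing, so [x] may be taken in the
    fundamental domain. The displacement [y - x] is confined because the logarithm is unbounded
    while [u] is bounded. What remains is a maximum over a compact set, with coordinates [x],
    [y - x] and [t]. *)
Lemma two_point_attains_max T t0 u (G : set 'rV[R]_n) (k c a : R) :
  0 <= t0 <= T -> {within slab T, continuous u} -> lattice G ->
  (forall t, 0 <= t <= T -> lattice_periodic G (fun x => u (x, t))) ->
  0 < c -> 0 < a ->
  exists x y t, 0 <= t <= t0 /\
    forall x' y' t', 0 <= t' <= t0 ->
      two_point u k c a x' y' t' <= two_point u k c a x y t.
Proof.
move=> /andP[t00 t0T] cu GL per c0 a0.
have T0 := le_trans t00 t0T.
have [U uU] := slab_periodic_bounded T u G T0 cu GL per.
have [B GB] := lattice_fundamental_domain G GL.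
have tT t : 0 <= t <= t0 -> 0 <= t <= T.
  by move=> /andP[-> tt]; exact: le_trans tt t0T.
(* Beyond distance [L] the barrier is at least [2 * U + |k| * t0], an upper bound for the other
   terms of [two_point]. *)
pose L := a * expR ((2 * U + `|k| * t0) / c).
pose K : set ('rV[R]_n * 'rV[R]_n * R) := box 0 1 `*` box (- L) L `*` `[0, t0]%classic.
have L0 : 0 < L by rewrite mulr_gt0// expR_gt0.
have cK : compact K.
  by repeat apply: compact_setX; [exact: compact_box..|exact: segment_compact].
have K00 : K (0, 0, 0).
  split => [|] /=; last by rewrite in_itv /= lexx.
  split => i /=; rewrite mxE in_itv /= ?lexx ?ler01//.
  by rewrite oppr_le0 ltW.
pose F (z : 'rV[R]_n * 'rV[R]_n * R) :=
  two_point u k c a (z.1.1 *m B) (z.1.1 *m B + z.1.2) z.2.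
have cF : {within K, continuous F}.
  have c11 : continuous (fun z : 'rV[R]_n * 'rV[R]_n * R => z.1.1 *m B).
    move=> z; apply: (@cvg_comp _ _ _ (fun z => z.1.1) (fun v => v *m B) (nbhs z) (nbhs z.1.1)).
      by apply: (@cvg_comp _ _ _ fst fst (nbhs z) (nbhs z.1)); exact: cvg_fst.
    exact: continuous_mulmxr.
  have c12 : continuous (fun z : 'rV[R]_n * 'rV[R]_n * R => z.1.2).
    move=> z; apply: (@cvg_comp _ _ _ fst snd (nbhs z) (nbhs z.1)); first exact: cvg_fst.
    exact: cvg_snd.
  have c2 : continuous (fun z : 'rV[R]_n * 'rV[R]_n * R => z.2) by move=> z; exact: cvg_snd.
  have cs : continuous (fun z : 'rV[R]_n * 'rV[R]_n * R => z.1.1 *m B + z.1.2).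
    by move=> z; apply: (@cvgD _ _ _ (nbhs z)); [exact: c11|exact: c12].
  have cp (h : 'rV[R]_n * 'rV[R]_n * R -> 'rV[R]_n) : continuous h ->
      {within K, continuous (u \o (fun z => (h z, z.2)))}.
    move=> ch; apply: (within_continuous_pull _ _ _ K _ _ u cu).
      move=> z; apply: (@cvg_pair _ _ _ (nbhs z) (nbhs (h z)) (nbhs z.2)); first exact: ch.
      exact: c2.
    by move=> z [_ /=]; rewrite in_itv => /tT.
  have /subspace_continuousP cy := cp _ cs; have /subspace_continuousP cx := cp _ c11.
  apply/subspace_continuousP => z Kz.
  apply: cvgB; [apply: cvgD; [apply: cvgB; [exact: cy|exact: cx]|]|].
    by apply: cvg_within_filter; apply: cvgMl_tmp; exact: c2.
  apply: cvg_within_filter; apply: cvgMl_tmp.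
  pose q := 1 + enorm (z.1.1 *m B + z.1.2 - z.1.1 *m B) / a.
  have q0 : 0 < q by rewrite ltr_pwDl// divr_ge0 ?enorm_ge0 ?ltW.
  apply: (@cvg_comp _ _ _ (fun z : 'rV[R]_n * 'rV[R]_n * R =>
      1 + enorm (z.1.1 *m B + z.1.2 - z.1.1 *m B) / a) (@ln R) (nbhs z) (nbhs q)); last first.
    exact: continuous_ln.
  apply: (@cvgD _ _ _ (nbhs z)); first exact: cvg_cst.
  apply: (@cvgMr_tmp _ _ (nbhs z)).
  apply: (@cvg_comp _ _ _ (fun z : 'rV[R]_n * 'rV[R]_n * R =>
      z.1.1 *m B + z.1.2 - z.1.1 *m B) (@enorm R n) (nbhs z)
      (nbhs (z.1.1 *m B + z.1.2 - z.1.1 *m B))); last exact: continuous_enorm.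
  by apply: (@cvgB _ _ _ (nbhs z)); [exact: cs|exact: c11].
have [[[f w] t] Kz zmax] := compact_EVT_max (ex_intro K _ K00) cK cF.
exists (f *m B), (f *m B + w), t; split.
  by move: Kz; rewrite inE => -[_] /=; rewrite in_itv.
move=> x' y' t' t't0.
have [f' [g [f01 Gg xE]]] := GB x'.
have [bw|bw] := pselect (box (- L) L (y' - x')).
  have := zmax (f', y' - x', t'); rewrite inE.
  have -> : F (f', y' - x', t') = two_point u k c a x' y' t'.
    have pg z : u (z + g, t') = u (z, t') by exact: (per t' (tT _ t't0) g z Gg).
    have e1 : u (f' *m B + (y' - x'), t') = u (y', t').
      by rewrite -pg addrAC -xE addrC subrK.
    have e2 : u (f' *m B, t') = u (x', t') by rewrite xE pg.
    by rewrite /F /two_point /= e1 e2 [f' *m B + _]addrC addrK.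
  apply; split => /=; last by rewrite in_itv.
  by split => // i /=; rewrite in_itv /=; exact: f01.
(* Outside the box [two_point] is at most 0, its value at [x = y = 0], [t = 0]. *)
apply: le_trans (zmax (0, 0, 0) _); last by rewrite inE.
have -> : F (0, 0, 0) = 0.
  by rewrite /F /two_point /= !(addr0, subrr, enorm0, mul0r, ln1, mulr0).
have Lw : L < enorm (y' - x').
  rewrite ltNge; apply/negP => wL; apply: bw => i /=; rewrite in_itv /= -ler_norml.
  exact: le_trans (coord_le_enorm _ _) wL.
have lnL : (2 * U + `|k| * t0) / c <= ln (1 + enorm (y' - x') / a).
  rewrite -[leLHS]expRK ler_ln ?posrE ?expR_gt0//; last first.
    by rewrite ltr_pwDl// divr_ge0 ?enorm_ge0 ?ltW.
  rewrite -(ler_pM2l a0) mulrDr mulrCA divff ?gt_eqF// !mulr1.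
  by apply: le_trans (ltW Lw) _; rewrite lerDr ltW.
have kt : k * t' <= `|k| * t0.
  have /andP[t'0 t't] := t't0.
  by rewrite (le_trans (ler_norm _))// normrM (ger0_norm t'0) ler_wpM2l.
have uy := uU y' t' (tT _ t't0); have ux := uU x' t' (tT _ t't0).
move: lnL; rewrite ler_pdivrMr// /two_point.
move: uy ux kt; rewrite !ler_norml.
move: (u (y', t')) (u (x', t')) (k * t') (`|k| * t0) (ln _) => p q r s l.
clear; rewrite [c * l]mulrC; move: (l * c) => {}l.
move=> /andP[? ?] /andP[? ?] ? ?; lra.
Qed.

End TwoPointMaximum.

(** * The parabolic maximum principle for two points *)

Section MaximumPrinciple.
Context {R : realType} {n : nat}.
Variables (T : R) (A : 'rV[R]_n * R -> 'M[R]_n) (b u : 'rV[R]_n * R -> R).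
Hypothesis A_sym : forall p t, 0 <= t <= T -> (A (p, t))^T = A (p, t).
Hypothesis A_psd : forall p t, 0 <= t <= T -> psdmx (A (p, t)).
Hypothesis u_C2 : Ck_on (slab T) 2 u.
Hypothesis u_sol : solves T A b u.

Let ut (t : R) : 'rV[R]_n -> R := fun x => u (x, t).

Let H (x y : 'rV[R]_n) (t : R) : 'M[R]_n := hess (ut t) y - hess (ut t) x.

Let u_C1 : Ck_on (slab T) 1 u.
Proof. by case: u_C2 => u0 u2; split => // v; have [du [cdu _]] := u2 v. Qed.

Let ut_C2 (t : R) : 0 <= t <= T -> dir_C2 (ut t).
Proof. by move=> tT; exact: slice_dir_C2 tT u_C2. Qed.

(** * First and second order conditions at a maximum *)

Section AtMaximum.
Variables (k c a t : R) (x y : 'rV[R]_n).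
Hypothesis t_itv : 0 < t <= T.
Hypothesis xy_max : forall x' y' t', 0 <= t' <= t ->
  two_point u k c a x' y' t' <= two_point u k c a x y t.

Let tT : 0 <= t <= T. Proof. by case/andP: t_itv => /ltW -> ->. Qed.

Let tt : 0 <= t <= t. Proof. by rewrite lexx andbT; case/andP: tT. Qed.

Let dut v z : derivable (ut t) z v. Proof. exact: ((ut_C2 t tT).1 v).1. Qed.

Let d2ut v w z : derivable ('D_v (ut t)) z w.
Proof. exact: ((ut_C2 t tT).2 v w).1. Qed.

(** A common translation of both points leaves [y - x], and with it the barrier, unchanged. No
    differentiability of the barrier is involved, so [x = y] is allowed here. *)
Let translate_max v h : ut t (y + h *: v) - ut t (x + h *: v) <= ut t y - ut t x.
Proof.
have := xy_max (x + h *: v) (y + h *: v) t tt.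
by rewrite /two_point opprD addrACA subrr addr0 !lerD2r.
Qed.

Let is_derive_translate v h :
  is_derive (h : R) 1 (fun h : R => ut t (y + h *: v) - ut t (x + h *: v))
    ('D_v (ut t) (y + h *: v) - 'D_v (ut t) (x + h *: v)).
Proof. by apply: is_deriveB; apply: is_derive_line. Qed.

Lemma max_grad_eq : grad (ut t) y = grad (ut t) x.
Proof.
apply/rowP => i; rewrite !mxE /partial; apply/eqP; rewrite -subr_eq0; apply/eqP.
have d0 := is_derive_translate 'e_i 0; rewrite !scale0r !addr0 in d0.
apply: (is_derive_local_max _ _ _ d0).
  by near=> h; have ? := is_derive_translate 'e_i h; exact: ex_derive.
by near=> h; rewrite !scale0r !addr0; exact: translate_max.
Unshelve. all: by end_near. Qed.

Lemma max_hess_le0 v : qform (H x y t) v <= 0.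
Proof.
have -> : qform (H x y t) v = 'D_v ('D_v (ut t)) y - 'D_v ('D_v (ut t)) x.
  rewrite !dir_derive2_hess; [|exact: ut_C2..].
  by rewrite /qform mulmxBr mulmxBl [LHS]mxE [X in _ + X]mxE.
apply: (@local_max_second_derive _ (fun h : R => ut t (y + h *: v) - ut t (x + h *: v))
  (fun h : R => 'D_v (ut t) (y + h *: v) - 'D_v (ut t) (x + h *: v))).
- by near=> h; exact: is_derive_translate.
- rewrite -[in X in X - _](addr0 y) -[in X in _ - X](addr0 x) -(scale0r v).
  by apply: is_deriveB; apply: is_derive_line.
- by near=> h; rewrite !scale0r !addr0; exact: translate_max.
Unshelve. all: by end_near. Qed.

(** The time condition at fixed [x] and [y] bounds the difference of the time derivatives. The
    equation rewrites this difference, and by [max_grad_eq] both points share the same matrix [A]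
    and the same value of [b]. *)
Lemma max_trace_ge0 :
  0 <= k + \sum_(i < n) \sum_(j < n) A (grad (ut t) x, t) i j * H x y t i j.
Proof.
have -> : \sum_(i < n) \sum_(j < n) A (grad (ut t) x, t) i j * H x y t i j =
    dtime T u y t - dtime T u x t.
  have sol z : dtime T u z t =
      \sum_(i < n) \sum_(j < n) A (grad (ut t) z, t) i j * partial i (partial j (ut t)) z
      + b (grad (ut t) z, t) := u_sol z t t_itv.
  rewrite (sol y) (sol x) max_grad_eq.
  have subrDr (p q r : R) : p + r - (q + r) = p - q by rewrite opprD addrACA subrr addr0.
  rewrite subrDr.
  rewrite -sumrB; apply: eq_bigr => i _; rewrite -sumrB; apply: eq_bigr => j _.
  by rewrite !mxE mulrBr.
apply: dtime_ge_of_max t_itv u_C1 _ => s st.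
by have := xy_max x y s st; rewrite /two_point lerD2r.
Qed.

End AtMaximum.


(** * Oscillation bound and logarithmic modulus of continuity *)

Section Estimates.
Variables (G : set 'rV[R]_n) (M : R).
Hypothesis T_gt0 : 0 < T.
Hypothesis G_lattice : lattice G.
Hypothesis u_per : forall t, 0 <= t <= T -> lattice_periodic G (fun x => u (x, t)).
Hypothesis osc0 : forall x y, u (y, 0) - u (x, 0) <= M.

Let ln_barrier_ge0 (a : R) (v : 'rV[R]_n) : 0 < a -> 0 <= ln (1 + enorm v / a).
Proof.
move=> a0; have va : 0 <= enorm v / a by rewrite divr_ge0 ?enorm_ge0 ?ltW.
by rewrite -(@ln1 R) ler_ln ?posrE// ?lerDl// ltr_pwDl.
Qed.

Let two_point_init k c a x y : 0 < c -> 0 < a -> two_point u k c a x y 0 <= M.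
Proof.
move=> c0 a0; rewrite /two_point mulr0 addr0 lerBlDr (le_trans (osc0 x y))//.
by rewrite lerDl mulr_ge0 ?(ltW c0)// ln_barrier_ge0.
Qed.

(* Penalising by d (t + ln (1 + |y - x|)) makes the maximum strict and attained. *)
Lemma osc_le x y t : 0 <= t <= T -> u (y, t) - u (x, t) <= M.
Proof.
move=> tT.
have weak d : 0 < d -> two_point u (- d) d 1 x y t <= M.
  move=> d0.
  have TT : 0 <= T <= T by rewrite lexx ltW.
  have [x1 [y1 [t1 [t1T zmax]]]] :=
    two_point_attains_max T T u G (- d) d 1 TT u_C2.1 G_lattice u_per d0 ltr01.
  apply: le_trans (zmax _ _ _ tT) _.
  have /andP[t10 t1T'] := t1T.
  move: t10; rewrite le_eqVlt => /predU1P[<-|t10]; first exact: two_point_init.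
  have t1T2 : 0 < t1 <= T by rewrite t10.
  have zmax' x' y' t' : 0 <= t' <= t1 ->
      two_point u (- d) d 1 x' y' t' <= two_point u (- d) d 1 x1 y1 t1.
    by move=> /andP[t'0 t't]; apply: zmax; rewrite t'0 (le_trans t't).
  have := max_trace_ge0 _ _ _ _ _ _ t1T2 zmax'.
  have := psd_trace_le0 _ (H x1 y1 t1) (A_sym (grad (ut t1) x1) _ t1T)
    (A_psd (grad (ut t1) x1) _ t1T) (max_hess_le0 _ _ _ _ _ _ t1T2 zmax').
  move=> tr0; rewrite addrC subr_ge0 => /le_trans/(_ tr0).
  by rewrite leNgt d0.
(* The total penalty is [d * (N - 1)]; the extra 1 makes [N] positive, and [d = e / N] makes the
   penalty at most [e]. *)
pose N := t + ln (1 + enorm (y - x) / 1) + 1.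
have N0 : 0 < N by rewrite ltr_wpDl// addr_ge0 ?ln_barrier_ge0//; case/andP: tT.
apply/ler_addgt0Pr => e e0.
have := weak (e / N) (divr_gt0 e0 N0).
rewrite /two_point mulNr -addrA -opprD -mulrDr lerBlDr => /le_trans; apply.
rewrite lerD2l mulrAC ler_pdivrMr// ler_wpM2l ?(ltW e0)//.
by rewrite /N lerDl ler01.
Qed.

(** [lam] is the reciprocal of the barrier coefficient c, and the time coefficient is k =
    [2 * A0 * lam]. Thus [lam_def] says that k times [t0] is [M]. *)
Variables (A0 P lam t0 : R) (alphat : R -> R).
Hypotheses (A0_gt0 : 0 < A0) (P_gt0 : 0 < P) (lam_gt0 : 0 < lam).
Hypothesis t0_itv : 0 < t0 <= T.
Hypothesis lam_def : 2 * A0 * lam * t0 = M.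
Hypothesis alphaE : forall p t, p != 0 -> 0 <= t <= T ->
  alpha (A (p, t)) p = alphat (enorm p).
Hypothesis alpha_ge : forall p : 'rV[R]_n, P <= enorm p ->
  A0 <= alphat (enorm p) * enorm p ^+ 2.

(* Chosen so that the barrier slope lam^-1 / (a + r) is at least P as long as the
   barrier lam^-1 ln (1 + r / a) is at most M. *)
Let a : R := expR (- (lam * M)) / (lam * P).

Let a_gt0 : 0 < a.
Proof. by rewrite divr_gt0 ?expR_gt0// mulr_gt0. Qed.

Let c_gt0 : 0 < lam^-1. Proof. by rewrite invr_gt0. Qed.

Let ln_diff_le (X Y : R) : 0 < X -> 0 < Y -> ln X - ln Y <= (X - Y) / Y.
Proof.
move=> X0 Y0; rewrite -ln_div ?posrE//.
have -> : X / Y = 1 + (X - Y) / Y by field; rewrite gt_eqF.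
apply: le_ln1Dx.
by rewrite ltr_pdivlMr// mulN1r ltrBrDl subrr.
Qed.

(** * Excluding a maximum above [M] at a positive time *)

Section Barrier.
Variables (t : R) (x y : 'rV[R]_n).
Hypothesis t_itv : 0 < t <= t0.
Hypothesis xy_max : forall x' y' t', 0 <= t' <= t ->
  two_point u (2 * A0 * lam) lam^-1 a x' y' t' <=
  two_point u (2 * A0 * lam) lam^-1 a x y t.
Hypothesis xy_large : M < two_point u (2 * A0 * lam) lam^-1 a x y t.

Let w := y - x.
Let r := enorm w.
(** Chosen so that [s *: w] is the gradient of the barrier at [w]. *)
Let s := lam^-1 / ((a + r) * r).

Let tT' : 0 < t <= T.
Proof.
by case/andP: t_itv => -> tt0 /=; apply: le_trans tt0 _; case/andP: t0_itv.
Qed.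

Let tT : 0 <= t <= T. Proof. by case/andP: tT' => /ltW -> ->. Qed.

Let tt : 0 <= t <= t. Proof. by rewrite lexx andbT; case/andP: tT. Qed.

Let kt_le : 2 * A0 * lam * t <= M.
Proof.
rewrite -lam_def ler_wpM2l//; last by case/andP: t_itv.
by rewrite !mulr_ge0// ltW.
Qed.

(** On the diagonal [two_point] reduces to its time term, which is at most [M]. The maximum thus
    avoids the corner of the barrier. *)
Let r_gt0 : 0 < r.
Proof.
rewrite enorm_gt0 subr_eq0; apply: contraTneq xy_large => yx.
rewrite -leNgt /two_point yx !subrr enorm0 mul0r addr0 ln1 mulr0 subr0 add0r.
exact: kt_le.
Qed.

Let ar_gt0 : 0 < a + r. Proof. exact: addr_gt0. Qed.

(** Since [osc_le] bounds the difference of [u] by [M] and the time term is at most [M], a value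
    above [M] forces the barrier below [M]. By the choice of [a] the slope there exceeds [P]. *)
Let P_lt : P < lam^-1 / (a + r).
Proof.
have : lam^-1 * ln (1 + r / a) < M.
  have := osc_le x y t tT; have := xy_large; have := kt_le.
  rewrite /two_point -/w -/r.
  move: (u (y, t) - u (x, t)) (2 * A0 * lam * t) (lam^-1 * _) => p q z.
  lra.
rewrite mulrC ltr_pdivrMr// [M * _]mulrC -(ltr_expR (ln _)) lnK ?posrE; last first.
  by rewrite ltr_pwDl// divr_ge0 ?ltW.
move=> lt1; rewrite ltr_pdivlMr// mulrC -(ltr_pM2r lam_gt0) mulVf ?gt_eqF//.
have -> : (a + r) * P * lam = (1 + r / a) * (a * (lam * P)).
  by field; rewrite gt_eqF.
rewrite /a divfK ?gt_eqF ?mulr_gt0// -/a expRN.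
by rewrite ltr_pdivrMr ?expR_gt0// mul1r.
Qed.

Let dut v z : derivable (ut t) z v. Proof. exact: ((ut_C2 t tT).1 v).1. Qed.

Let d2ut v z q : derivable ('D_v (ut t)) z q.
Proof. exact: ((ut_C2 t tT).2 v q).1. Qed.

(* [enormD_le] and concavity of ln replace the derivative of the norm. *)
Let dir_derive_y v : 'D_v (ut t) y = lam^-1 / (a + r) * (dotv w v / r).
Proof.
set d := (RHS); pose K := lam^-1 / (a + r) * (dotv v v / (2 * r)).
apply/eqP; rewrite -subr_eq0; apply/eqP.
(* The barrier increment is replaced by a quadratic majorant with linear coefficient [d]; [g] keeps
   its maximum at 0, so its derivative there vanishes. *)
pose g (h : R) := ut t (y + h *: v) - (h * d + h ^+ 2 * K).
have dg (h : R) : is_derive h 1 g ('D_v (ut t) (y + h *: v) - (d + 2 * h * K)).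
  apply: is_deriveB; first exact: is_derive_line.
  apply: is_deriveD.
    have := is_deriveZ d (is_derive_id h (1 : R)).
    rewrite /GRing.scale /= mulr1; congr (is_derive _ _ _ _).
    by apply/funext => z /=; rewrite mulrC.
  have := is_deriveZ K (is_deriveX 2 (is_derive_id h (1 : R))).
  rewrite /GRing.scale /= mulr1 expr1 [K * _]mulrC; congr (is_derive _ _ _ _).
  by apply/funext => z /=; rewrite mulrC.
have := dg 0; rewrite mulr0 mul0r addr0 scale0r addr0 => dg0.
apply: (is_derive_local_max g _ _ dg0).
  by near=> h; have ? := dg h; exact: ex_derive.
near=> h; rewrite /g mul0r expr0n mul0r addr0 subr0 scale0r addr0.
have := xy_max x (y + h *: v) t tt.
rewrite /two_point (_ : y + h *: v - x = w + h *: v) -/w -/r; last by rewrite addrAC.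
have ln_le : lam^-1 * (ln (1 + enorm (w + h *: v) / a) - ln (1 + r / a)) <=
    h * d + h ^+ 2 * K.
  have -> : h * d + h ^+ 2 * K =
      lam^-1 * ((dotv w (h *: v) / r + dotv (h *: v) (h *: v) / (2 * r)) / (a + r)).
    rewrite dotvZl !dotvZr /d /K; field.
    by rewrite !gt_eqF.
  rewrite ler_pM2l//.
  have D0 z : 0 <= z -> 0 < 1 + z / a by move=> z0; rewrite ltr_pwDl// divr_ge0// ltW.
  apply: le_trans (ln_diff_le _ _ (D0 _ (enorm_ge0 _)) (D0 _ (ltW r_gt0))) _.
  rewrite (_ : _ / (1 + r / a) = (enorm (w + h *: v) - r) / (a + r)); last first.
    by field; rewrite !gt_eqF.
  rewrite ler_pM2r ?invr_gt0// lerBlDl addrA.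
  exact: enormD_le.
move: ln_le; rewrite mulrBr /ut.
move: (u (y + _, t)) (u (y, t)) (u (x, t)) (2 * A0 * lam * t) (lam^-1 * _)
  (lam^-1 * _) (h * d + _) => p1 p2 p3 p4 p5 p6 p7; lra.
Unshelve. all: by end_near. Qed.

Let grad_y : grad (ut t) y = s *: w.
Proof.
apply/rowP => i; rewrite !mxE /partial dir_derive_y dotv_delta /s.
by rewrite !mxE; field; rewrite !gt_eqF.
Qed.

Let grad_norm : enorm (grad (ut t) y) = lam^-1 / (a + r).
Proof.
rewrite grad_y enormZ ger0_norm -/r /s; first by field; rewrite !gt_eqF.
by rewrite divr_ge0// ltW// mulr_gt0.
Qed.

(* Second variation along (x, y) -> (x - h w, y + h w), in which |y - x| grows
   at the rate 2 r. *)
Let hess_w_le : qform (H x y t) w <= - (4 * lam^-1 * r ^+ 2 / (a + r) ^+ 2).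
Proof.
pose m := r / a; have m0 : 0 < m by rewrite divr_gt0.
(* The argument of the logarithm along the variation, where the displacement is
   [(1 + 2 * h) *: w]. *)
pose q (h : R) := (1 + m) + h * (2 * m).
have dq (h : R) : is_derive h 1 q (2 * m).
  have := is_deriveD (is_derive_cst (1 + m) h (1 : R))
    (is_deriveZ (2 * m) (is_derive_id h (1 : R))).
  rewrite /GRing.scale /= mulr1 add0r; congr (is_derive _ _ _ _).
  by apply/funext => z /=; rewrite /q [z * _]mulrC.
pose g h := ut t (y + h *: w) - ut t (x + (h * -1) *: w) - lam^-1 * ln (q h).
pose k h := 'D_w (ut t) (y + h *: w) - -1 * 'D_w (ut t) (x + (h * -1) *: w)
  - lam^-1 * ((q h)^-1 * (2 * m)).
(* Here [1 + 2 * h] is positive, so the norm of the displacement is affine in [h] and [q] is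
   positive. *)
have near_small : \forall h \near (0 : R), -1 < 2 * h.
  have : \forall h \near (0 : R), `|h| < 2^-1 by apply: nbhs0_lt; rewrite invr_gt0.
  apply: filterS => h; rewrite ltr_norml => /andP[h1 _]; lra.
have q_gt0 h : -1 < 2 * h -> 0 < q h.
  move=> h1; rewrite /q -addrA ltr_pwDl// mulrCA -[X in X + _]mul1r mulrA -mulrDl.
  by rewrite mulr_ge0 ?(ltW m0)//; lra.
have l0 : is_derive (0 : R) 1 k (qform (H x y t) w + 4 * lam^-1 * r ^+ 2 / (a + r) ^+ 2).
  have q0 : q 0 != 0 by rewrite gt_eqF// q_gt0// mulr0 ltrN10.
  have d1 := is_derive_line _ _ _ _ (d2ut w (y + 0 *: w) w).
  have d2 := is_derive_lineZ _ _ _ _ _ (d2ut w (x + (0 * -1) *: w) w).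
  have d3 := is_deriveV q0 (dq 0).
  have := is_deriveB (is_deriveB d1 (is_deriveZ (-1) d2))
    (is_deriveZ lam^-1 (is_deriveZ (2 * m) d3)).
  have -> : qform (H x y t) w = 'D_w ('D_w (ut t)) y - 'D_w ('D_w (ut t)) x.
    rewrite !dir_derive2_hess; [|exact: ut_C2..].
    by rewrite /qform mulmxBr mulmxBl [LHS]mxE [X in _ + X]mxE.
  rewrite !mul0r !scale0r !addr0 /GRing.scale /= => dk.
  have is_derive_congr f l l' : is_derive (0 : R) 1 f l -> f = k -> l = l' ->
    is_derive (0 : R) 1 k l' by move=> df <- <-.
  apply: is_derive_congr dk _ _.
    by apply/funext => h; rewrite /k (mulrC (q h)^-1).
  rewrite /q mul0r addr0 /m; move: ('D_w _ _) ('D_w _ _) => d e.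
  by field; rewrite !gt_eqF.
rewrite -subr_le0 opprK; apply: (local_max_second_derive g k _ _ l0).
  near=> h.
  have qh : 0 < q h by apply: q_gt0; near: h.
  apply: is_deriveB; first by apply: is_deriveB; [exact: is_derive_line|exact: is_derive_lineZ].
  exact: (is_deriveZ lam^-1 (@is_derive1_comp _ _ q h _ _ (is_derive1_ln qh) (dq h))).
near=> h; have h1 : -1 < 2 * h by near: h.
have := xy_max (x + (h * -1) *: w) (y + h *: w) t tt.
rewrite /two_point -/w -/r.
have -> : y + h *: w - (x + (h * -1) *: w) = (1 + 2 * h) *: w.
  rewrite mulrN1 scaleNr opprD opprK addrACA -/w.
  by rewrite scalerDl scale1r mulrDl !mul1r scalerDl.
rewrite enormZ gtr0_norm -/r; last lra.
have -> : 1 + (1 + 2 * h) * r / a = q h by rewrite /q /m; ring.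
rewrite /g /q !mul0r !scale0r !addr0 -/m /ut.
move: (u (y + _, t)) (u (y, t)) (u (x, t)) (u (x + _, t)) (lam^-1 * _) (lam^-1 * _)
  (2 * A0 * lam * t) => p1 p2 p3 p4 p5 p6 p7; lra.
Unshelve. all: by end_near. Qed.

Lemma barrier_max_absurd : False.
Proof.
have gxy : grad (ut t) y = grad (ut t) x := max_grad_eq _ _ _ _ _ _ tT' xy_max.
set p := grad (ut t) x in gxy.
have pn : enorm p = lam^-1 / (a + r) by rewrite -gxy grad_norm.
have p0 : p != 0 by rewrite -enorm_gt0 pn divr_gt0.
set B := A (p, t).
have Bpsd : psdmx B := A_psd p t tT.
set al := alpha B p.
have al_ge : A0 <= al * enorm p ^+ 2.
  by rewrite /al alphaE// alpha_ge// pn ltW.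
(* Since [p = s *: w], the matrix [be *: (w^T *m w)] is [al] times the projection onto [p], and
   [alpha_rank1] makes [C] positive semidefinite. *)
pose be := al / r ^+ 2.
pose C := B - be *: (w^T *m w).
have Cij i j : C i j = B i j - be * (w 0 i * w 0 j).
  by rewrite /C; move: (w) => w'; rewrite !mxE big_ord1 !mxE.
have Csym : C^T = C.
  by rewrite linearB linearZ /= trmx_mul trmxK A_sym.
have Cpsd : psdmx C.
  move=> v; rewrite qformB_rank1 subr_ge0.
  have := alpha_rank1 B p v Bpsd p0; rewrite -/al -gxy grad_y dotvZr enormZ -/r.
  rewrite (exprMn 2 s (dotv v w)) (exprMn 2 `|s| r) real_normK ?num_real//.
  have s0 : 0 < s ^+ 2 by rewrite exprn_gt0// divr_gt0// mulr_gt0.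
  rewrite -[s ^+ 2 * _ * _]mulrA [al * (_ * _)]mulrCA ler_pM2l// => le1.
  by rewrite /be mulrAC ler_pdivrMr ?exprn_gt0// [leRHS]mulrC.
have tr := max_trace_ge0 _ _ _ _ _ _ tT' xy_max; rewrite -/p -/B in tr.
have trC := psd_trace_le0 C (H x y t) Csym Cpsd (max_hess_le0 _ _ _ _ _ _ tT' xy_max).
have trE : \sum_(i < n) \sum_(j < n) C i j * H x y t i j =
    \sum_(i < n) \sum_(j < n) B i j * H x y t i j - be * qform (H x y t) w.
  rewrite qformE big_distrr -sumrB; apply: eq_bigr => i _.
  rewrite big_distrr -sumrB; apply: eq_bigr => j _ /=.
  by rewrite Cij; ring.
rewrite trE subr_le0 in trC.
have al0 : 0 < al.
  have p2 : 0 < enorm p ^+ 2 by rewrite exprn_gt0// enorm_gt0.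
  by rewrite -(pmulr_lgt0 al p2) (lt_le_trans A0_gt0).
have be0 : 0 <= be by rewrite divr_ge0 ?ltW// exprn_gt0.
(* As [enorm p] is the slope [lam^-1 / (a + r)], the trace is at most
   [- 4 * lam * al * enorm p ^+ 2], hence at most [- 4 * lam * A0]. The time coefficient
   [2 * A0 * lam] cannot compensate for this. *)
have := le_trans trC (ler_wpM2l be0 hess_w_le).
have -> : be * - (4 * lam^-1 * r ^+ 2 / (a + r) ^+ 2) = - (4 * lam * (al * enorm p ^+ 2)).
  by rewrite pn /be; field; rewrite !gt_eqF.
move: tr al_ge; have := mulr_gt0 A0_gt0 lam_gt0.
move: (\sum_(i < n) _) (al * _) => S q; move: lam_gt0 A0_gt0 => l0 a0 la tr qa Sq.
have : 4 * lam * A0 <= 4 * lam * q by rewrite ler_pM2l// mulr_gt0.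
lra.
Qed.

End Barrier.

(** At time [t0] the time term equals [M] and cancels the bound [M] on [two_point]. The remaining
    logarithm lies below its tangent at 0, of slope [lam^-1 / a], which is [P * expR (lam * M)]. *)
Lemma log_lipschitz x y :
  u (y, t0) - u (x, t0) <= P * expR (lam * M) * enorm (y - x).
Proof.
have /andP[t00 t0T] := t0_itv.
have t0T' : 0 <= t0 <= T by rewrite ltW.
have t0t0 : 0 <= t0 <= t0 by rewrite ltW//=.
suff : two_point u (2 * A0 * lam) lam^-1 a x y t0 <= M.
  rewrite /two_point lam_def lerBlDr [leRHS]addrC lerD2r => /le_trans; apply.
  have ra : 0 <= enorm (y - x) / a by rewrite divr_ge0 ?enorm_ge0 ?ltW.
  apply: le_trans (ler_wpM2l (ltW c_gt0) (le_ln1Dx _)) _.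
    by rewrite (lt_le_trans _ ra)// ltrN10.
  rewrite /a expRN le_eqVlt; apply/orP; left; apply/eqP; field.
  by rewrite !gt_eqF ?expR_gt0.
have [x1 [y1 [t1 [t1t zmax]]]] :=
  two_point_attains_max T t0 u G (2 * A0 * lam) lam^-1 a t0T' u_C2.1 G_lattice u_per c_gt0 a_gt0.
apply: le_trans (zmax _ _ _ t0t0) _; rewrite leNgt; apply/negP => large.
have /andP[t10 t1t0] := t1t.
move: t10; rewrite le_eqVlt => /predU1P[t10|t10].
  by move: large; rewrite -t10 ltNge two_point_init.
apply: (barrier_max_absurd t1 x1 y1) large; first by rewrite t10.
by move=> x' y' t' /andP[t'0 t't]; apply: zmax; rewrite t'0 (le_trans t't).
Qed.

End Estimates.

End MaximumPrinciple.

(** * From the Lipschitz bound to the gradient bound *)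

Section Gradient.
Context {R : realType} {n : nat}.

(** Differentiating in the direction of the gradient [p] itself gives
    [enorm p ^+ 2 <= L * enorm p]. *)
Lemma grad_le_of_lipschitz (f : 'rV[R]_n -> R) (L : R) (x : 'rV[R]_n) :
  dir_C1 f -> 0 <= L -> (forall y z, f z - f y <= L * enorm (z - y)) ->
  enorm (grad f x) <= L.
Proof.
move=> f1 L0 fL; set p := grad f x.
have [->|p0] := eqVneq p 0; first by rewrite enorm0.
rewrite -enorm_gt0 in p0; rewrite -(ler_pM2r p0) -expr2 enorm_sqr.
have -> : dotv p p = 'D_p f x.
  by rewrite dir_derive_partial//; apply: eq_bigr => i _; rewrite {2}/p mxE.
apply: limr_le; first exact: (f1 p).1.
near=> h.
have h0 : h != 0 by near: h; exact: nbhs_dnbhs_neq.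
rewrite /GRing.scale /=; case: (ltgtP h 0) h0 => // h0 _.
  rewrite mulrC ler_ndivrMr//.
  have := fL (h *: p + x) x.
  rewrite opprD addrCA subrr addr0 -scaleNr enormZ gtr0_norm ?oppr_gt0//.
  by rewrite -lerN2 opprB mulNr mulrN opprK [L * (h * _)]mulrCA [h * _]mulrC.
rewrite mulrC ler_pdivrMr//; have := fL x (h *: p + x).
by rewrite addrK enormZ gtr0_norm// [L * (h * _)]mulrCA [h * _]mulrC.
Unshelve. all: by end_near. Qed.

End Gradient.

(** The bound [U] guarantees that the real-valued [sup] and [inf] are genuine bounds of the
    range. *)
Lemma osc_diff_le (R : realType) (X : Type) (f : X -> R) (U : R) x y :
  (forall z, `|f z| <= U) -> f y - f x <= osc f.
Proof.
move=> fU; apply: lerB.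
  apply: ub_le_sup; last by exists y.
  by exists U => _ [z _ <-]; have := fU z; rewrite ler_norml => /andP[].
apply: ge_inf; last by exists x.
by exists (- U) => _ [z _ <-]; have := fU z; rewrite ler_norml => /andP[].
Qed.

Theorem corollary5p2 (R : realType) (n : nat) (M A0 P : R)
    (hn : (0 < n)%N) (hM : 0 < M) (hA0 : 0 < A0) (hP : 0 < P) :
  exists T' C1 C2 : R, 0 < T' /\
    forall (T : R) (A : 'rV[R]_n * R -> 'M[R]_n) (b u : 'rV[R]_n * R -> R)
        (u0 : 'rV[R]_n -> R) (G : set 'rV[R]_n) (alphat : R -> R),
      0 < T ->
      (forall i j : 'I_n, smooth_on (slab T) (fun z => A z i j)) ->
      (forall (p : 'rV[R]_n) (t : R), 0 <= t <= T ->
         (A (p, t))^T = A (p, t) /\ psdmx (A (p, t))) ->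
      smooth_on (slab T) u ->
      solves T A b u ->
      (forall x : 'rV[R]_n, u (x, 0) = u0 x) ->
      smooth_on setT u0 ->
      osc u0 <= M ->
      lattice G ->
      (forall t : R, 0 <= t <= T -> lattice_periodic G (fun x => u (x, t))) ->
      lattice_periodic G u0 ->
      (forall (p : 'rV[R]_n) (t : R), p != 0 -> 0 <= t <= T ->
         alpha (A (p, t)) p = alphat (enorm p)) ->
      alphat r @[r --> 0^'+] --> alphat 0 ->
      (forall p : 'rV[R]_n, 0 < alphat (enorm p)) ->
      (forall p : 'rV[R]_n, P <= enorm p ->
         A0 <= alphat (enorm p) * enorm p ^+ 2) ->
      forall (t : R) (x : 'rV[R]_n), 0 < t <= T' -> t <= T ->
        enorm (grad (fun y => u (y, t)) x)
          <= C1 * Num.sqrt t * (1 + t) * expR (C2 / t).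

Proof.
(* The Lipschitz constant has exponent [lam * M = M ^+ 2 / (2 * A0 * t)]. The added 1 supplies a
   factor [expR t^-1] that absorbs the small factor [Num.sqrt t]. *)
exists 1, P, (M ^+ 2 / (2 * A0) + 1); split; first exact: ltr01.
move=> T A b u u0 G alphat T0 _ Aprop usm usol uu0 _ oscM GL uper _ alphaE _ _ alpha_ge.
move=> t x /andP[t0 t1] tT.
have u2 : Ck_on (slab T) 2 u := usm 2%N.
have osc0 y z : u (z, 0) - u (y, 0) <= M.
  have [U uU] := slab_periodic_bounded T u G (ltW T0) u2.1 GL uper.
  apply: le_trans oscM; rewrite !uu0; apply: (osc_diff_le _ _ _ U) => v.
  by rewrite -uu0 uU// lexx ltW.
pose lam := M / (2 * A0 * t).
have lam0 : 0 < lam by rewrite divr_gt0// !mulr_gt0.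
have lamE : 2 * A0 * lam * t = M by rewrite /lam; field; rewrite !gt_eqF.
have t_itv : 0 < t <= T by rewrite t0.
have lip := log_lipschitz T A b u (fun p t tt => (Aprop p t tt).1)
  (fun p t tt => (Aprop p t tt).2) u2 usol G M T0 GL uper osc0 A0 P lam t alphat
  hA0 hP lam0 t_itv lamE alphaE alpha_ge.
have tT' : 0 <= t <= T by rewrite ltW.
have /le_trans := grad_le_of_lipschitz (fun y => u (y, t)) (P * expR (lam * M)) x
  (slice_dir_C2 T u t tT' u2).1 (mulr_ge0 (ltW hP) (expR_ge0 _)) lip.
apply.
have -> : (M ^+ 2 / (2 * A0) + 1) / t = lam * M + t^-1.
  by rewrite /lam; field; rewrite !gt_eqF.
rewrite expRD [expR _ * _]mulrC mulrA ler_wpM2r ?expR_ge0//.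
rewrite -!mulrA -[leLHS]mulr1 ler_pM2l//.
(* It remains to bound [Num.sqrt t * (1 + t) * expR t^-1] below by 1. For [t <= 1] it is at least
   [t * (1 + t) * t^-1 = 1 + t]. *)
have st : t <= Num.sqrt t.
  rewrite -[leLHS](ger0_norm (ltW t0)) -sqrtr_sqr ler_wsqrtr// expr2.
  by rewrite -[leRHS]mulr1 ler_wpM2l// ltW.
have e1 : t^-1 <= expR t^-1.
  by apply: le_trans (expR_ge1Dx _); rewrite lerDr.
apply: (@le_trans _ _ (t * ((1 + t) * t^-1))).
  by rewrite [_ * t^-1]mulrC mulrA divff ?gt_eqF// mul1r lerDl ltW.
apply: ler_pM => //; first exact: ltW.
  by rewrite mulr_ge0 ?invr_ge0 ?addr_ge0 ?ltW.
by rewrite ler_wpM2l// addr_ge0// ltW.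
Qed.
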